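(* Let $n\ge 3$. The map $g=[g_1,\dots,g_{n-1}]$ on $\mathbf{CP}^{n-2}$ is $T$-equivariant, i.e. $g\circ T=T\circ g$; hence $g$ is $\mathcal{G}_n$-equivariant, i.e. $g\circ M=M\circ g$ for every $M\in\mathcal{G}_n$.
   Context: Use homogeneous coordinates $u=(u_1,\dots,u_{n-1})$ on $\mathbf{CP}^{n-2}$. Let $T$ be the linear involution $T(u_1,u_2,\dots,u_{n-1})=(-u_1,\,u_2-u_1,\,\dots,\,u_{n-1}-u_1)$. Let $\mathcal{G}_n$ be the group of transformations of $\mathbf{CP}^{n-2}$ generated by all permutations of the coordinates $u_1,\dots,u_{n-1}$ together with $T$; it is isomorphic to the symmetric group $\mathcal{S}_n$ (it is the projectivization of the $(n-1)$-dimensional irreducible permutation representation of $\mathcal{S}_n$ on $\{x\in\mathbf{C}^n:\sum x_k=0\}$). Let $S_{n,\ell}$ be the elementary symmetric polynomial of degree $\ell$ in $u_1,\dots,u_{n-1}$, with $S_{n,0}=1$. Define $g=[g_1,\dots,g_{n-1}]$ by $$g_\ell=u_\ell^3\,G_\ell,\qquad G_\ell=\sum_{k=0}^{n-2}(-1)^k\,\frac{k+1}{k+3}\,u_\ell^k\,S_{n,n-2-k},\qquad \ell=1,\dots,n-1.$$ *)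

(* Defs.v *)
From mathcomp Require Import all_boot all_order perm all_algebra.
From mathcomp Require Import mpoly ring.

Set Implicit Arguments.
Unset Strict Implicit.
Unset Printing Implicit Defensive.

Import GRing.Theory Num.Theory.

Local Open Scope quotient_scope.
Local Open Scope ring_scope.

Definition hcoord (F : fieldType) (d : nat) := {u : 'rV[F]_d.+1 | u != 0}.

(* Equality of row spaces; [same_lineP] gives the description by scaling. *)
Definition same_line (F : fieldType) (d : nat) (u v : hcoord F d) : bool :=
  (val u == val v)%MS.

Lemma same_lineP (F : fieldType) (d : nat) (u v : hcoord F d) :
  reflect (exists2 c : F, c != 0 & val v = c *: val u) (same_line u v).
Proof.
apply: (iffP idP) => [/andP[_ /sub_rVP[c vE]]|[c c0 vE]].
  exists c => //; apply: contraNneq (valP v) => c0.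
  by rewrite vE c0 scale0r.
by rewrite /same_line vE; apply/eqmxP/eqmx_sym/eqmx_scale.
Qed.

Lemma same_line_refl (F : fieldType) (d : nat) : reflexive (@same_line F d).
Proof. by move=> u; rewrite /same_line !submx_refl. Qed.

Lemma same_line_sym (F : fieldType) (d : nat) : ssrbool.symmetric (@same_line F d).
Proof. by move=> u v; rewrite /same_line andbC. Qed.

Lemma same_line_trans (F : fieldType) (d : nat) : transitive (@same_line F d).
Proof.
move=> v u w /andP[uv vu] /andP[vw wv].
by apply/andP; split; [apply: submx_trans vw | apply: submx_trans vu].
Qed.

Canonical same_line_equiv (F : fieldType) (d : nat) :=
  EquivRel (@same_line F d) (@same_line_refl F d) (@same_line_sym F d)
           (@same_line_trans F d).

Definition proj_space (F : fieldType) (d : nat) : Type :=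
  {eq_quot @same_line F d}.

Record homog_map (F : fieldType) (d : nat) := HomogMap {
  hfun :> 'rV[F]_d.+1 -> 'rV[F]_d.+1;
  hdeg : nat;
  hfunZ : forall (c : F) (u : 'rV[F]_d.+1), hfun (c *: u) = c ^+ hdeg *: hfun u;
  hfun_neq0 : forall u : 'rV[F]_d.+1, u != 0 -> hfun u != 0
}.

Definition hcoord_map (F : fieldType) (d : nat) (f : homog_map F d)
    (u : hcoord F d) : hcoord F d :=
  exist _ (f (val u)) (hfun_neq0 f (valP u)).

Definition proj_map (F : fieldType) (d : nat) (f : homog_map F d)
    (p : proj_space F d) : proj_space F d :=
  \pi_(proj_space F d) (hcoord_map f (repr p)).

(* The choice of homogeneous coordinates in [proj_map] is immaterial. *)
Lemma proj_map_pi (F : fieldType) (d : nat) (f : homog_map F d)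
    (u : hcoord F d) :
  proj_map f (\pi_(proj_space F d) u) = \pi_(proj_space F d) (hcoord_map f u).
Proof.
apply/eqmodP/same_lineP => /=.
have /eqmodP/same_lineP[c c0 ->] :
  repr (\pi_(proj_space F d) u) = u %[mod proj_space F d] by rewrite reprK.
by exists (c ^+ hdeg f); rewrite ?expf_neq0 ?hfunZ.
Qed.

Lemma col_perm_homog (F : fieldType) (d : nat) (s : 'S_d.+1) (c : F)
    (u : 'rV[F]_d.+1) : col_perm s (c *: u) = c ^+ 1 *: col_perm s u.
Proof. by apply/rowP => i; rewrite !mxE. Qed.

Lemma col_perm_neq0 (F : fieldType) (d : nat) (s : 'S_d.+1)
    (u : 'rV[F]_d.+1) : u != 0 -> col_perm s u != 0.
Proof.
apply: contra_neq => /rowP su0; apply/rowP => i.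
by have := su0 ((s^-1)%g i); rewrite !mxE permKV.
Qed.

Definition perm_map (F : fieldType) (d : nat) (s : 'S_d.+1) : homog_map F d :=
  HomogMap (@col_perm_homog F d s) (@col_perm_neq0 F d s).

(* The coordinates u_1, ..., u_(n-1) are indexed from 0: [u 0 ord0] is u_1. *)
Definition Tfun (F : fieldType) (d : nat) (u : 'rV[F]_d.+1) : 'rV[F]_d.+1 :=
  \row_i (if i == ord0 then - u 0 ord0 else u 0 i - u 0 ord0).

Lemma Tfun_homog (F : fieldType) (d : nat) (c : F) (u : 'rV[F]_d.+1) :
  Tfun (c *: u) = c ^+ 1 *: Tfun u.
Proof. by apply/rowP => i; rewrite !mxE; case: ifP; rewrite ?mulrN ?mulrBr. Qed.

Lemma Tfun_neq0 (F : fieldType) (d : nat) (u : 'rV[F]_d.+1) :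
  u != 0 -> Tfun u != 0.
Proof.
apply: contra_neq => /rowP Tu0; apply/rowP => i.
have u00 : u 0 ord0 = 0.
  by apply/eqP; rewrite -oppr_eq0; have := Tu0 ord0; rewrite !mxE eqxx => ->.
have := Tu0 i; rewrite !mxE u00 subr0.
by case: eqP => [->|//]; rewrite u00.
Qed.

Definition Tmap (F : fieldType) (d : nat) : homog_map F d :=
  HomogMap (@Tfun_homog F d) (@Tfun_neq0 F d).

Inductive generated_group (X : Type) (S : (X -> X) -> Prop) :
    (X -> X) -> Prop :=
| Generated_gen f : S f -> generated_group S f
| Generated_id : generated_group S id
| Generated_comp f h :
    generated_group S f -> generated_group S h -> generated_group S (f \o h)
| Generated_inv f h :
    generated_group S f -> cancel f h -> cancel h f -> generated_group S h.

Definition Ggroup (F : fieldType) (d : nat) :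
    (proj_space F d -> proj_space F d) -> Prop :=
  generated_group (fun M =>
    (exists s : 'S_d.+1, M = proj_map (perm_map F s)) \/
    M = proj_map (Tmap F d)).

(* Below d = n - 2, so that there are d.+1 = n - 1 coordinates. *)

Definition Sym (F : fieldType) (d l : nat) (u : 'rV[F]_d.+1) : F :=
  (mesym d.+1 F l).@[u 0].

Definition Gcoef (F : fieldType) (d : nat) (l : 'I_d.+1) (u : 'rV[F]_d.+1) :
    F :=
  \sum_(k < d.+1)
    (-1) ^+ k * (k.+1%:R / k.+3%:R) * u 0 l ^+ k * Sym (d - k) u.

Definition gfun (F : fieldType) (d : nat) (u : 'rV[F]_d.+1) : 'rV[F]_d.+1 :=
  \row_l (u 0 l ^+ 3 * Gcoef l u).

Lemma SymE (F : fieldType) (d l : nat) (u : 'rV[F]_d.+1) :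
  Sym l u = \sum_(h : {set 'I_d.+1} | #|h| == l) \prod_(i in h) u 0 i.
Proof.
rewrite /Sym /mesym raddf_sum; apply: eq_bigr => h _.
by rewrite /= rmorph_prod; apply: eq_bigr => i _; rewrite /= mevalXU.
Qed.

Lemma SymZ (F : fieldType) (d l : nat) (c : F) (u : 'rV[F]_d.+1) :
  Sym l (c *: u) = c ^+ l * Sym l u.
Proof.
rewrite !SymE mulr_sumr; apply: eq_bigr => h /eqP <-.
by rewrite -prodr_const -big_split; apply: eq_bigr => i _; rewrite mxE.
Qed.

Lemma gfun_homog (F : fieldType) (d : nat) (c : F) (u : 'rV[F]_d.+1) :
  gfun (c *: u) = c ^+ (d + 3) *: gfun u.
Proof.
apply/rowP => l; rewrite !mxE /Gcoef !mulr_sumr.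
apply: eq_bigr => k _; rewrite SymZ mxE.
have kd : (k <= d)%N by rewrite -ltnS.
by rewrite !exprMn -[in c ^+ (d + 3)](subnKC kd) !exprD; ring.
Qed.

(* [gfun] has no common zero: up to sign the l-th coordinate of [gfun u] is
   E(u_l), where E' = x^2 P' for P the product of the x - u_j.  If E vanishes
   at every u_j, so does W = x^2 P - E, a primitive of 2xP; each root of xP is
   then a root of W of larger multiplicity, and deg W = 2 + deg P leaves room
   for one root only, namely 0. *)

Lemma mup_primitive (F : numFieldType) (b : F) (p : {poly F}) (m : nat) :
  root p b -> p^`() != 0 -> (m <= mup b p^`())%N -> (m < mup b p)%N.
Proof.
move=> pb p'0; have p0 : p != 0 by apply: contraNneq p'0 => ->; rewrite deriv0.
have [j [q]] := multiplicity_XsubC p b; rewrite p0 /= => qb pE.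
case: j pE => [|j] pE; first by move: pb; rewrite pE expr0 mulr1 (negPf qb).
pose r := q^`() * ('X - b%:P) + q *+ j.+1.
have p'E : p^`() = r * ('X - b%:P) ^+ j.
  by rewrite /r pE derivM deriv_exp derivXsubC /= exprS mul1r; ring.
have rb : ~~ root r b.
  by rewrite /r /root hornerD hornerM hornerXsubC subrr mulr0 add0r hornerMn mulrn_eq0.
rewrite p'E mupMr // pE mupMr // !mup_XsubCX eqxx; exact.
Qed.

Lemma dvdp_prod_mup (F : fieldType) (s : seq F) (p : {poly F}) :
  p != 0 -> (forall b, b \in s -> count_mem b s <= mup b p)%N ->
  \prod_(b <- s) ('X - b%:P) %| p.
Proof.
elim: s p => [|a s IH] p p0 sp; first by rewrite big_nil dvd1p.
have : 'X - a%:P %| p.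
  by rewrite XsubC_dvd //; have := sp a (mem_head _ _); rewrite /= eqxx; case: mup.
move=> /dvdpP[q pE]; have q0 : q != 0.
  by apply: contraNneq p0 => q0; rewrite pE q0 mul0r.
rewrite big_cons pE mulrC dvdp_mul2r ?polyXsubC_eq0 //.
apply: IH => // b bs; have := sp b; rewrite inE bs orbT => /(_ isT).
rewrite pE mupM ?polyXsubC_eq0 // (@mup_XsubCX _ 1) /=.
by case: eqP => _ /=; rewrite ?addn1 ?addn0.
Qed.

Section Nondegeneracy.

Variables (F : numFieldType) (d : nat) (u : 'rV[F]_d.+1).

Let P : {poly F} := \prod_(j < d.+1) ('X - (u 0 j)%:P).

Let E : {poly F} := \sum_(k < d.+1)
  ((-1) ^+ k * (k.+1%:R / k.+3%:R) * Sym (d - k) u) *: 'X^(k + 3).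

Let W : {poly F} := (-1) ^+ d *: ('X^2 * P) - E.

Lemma horner_E (l : 'I_d.+1) : E.[u 0 l] = gfun u 0 l.
Proof.
rewrite mxE /E /Gcoef horner_sum mulr_sumr; apply: eq_bigr => k _.
by rewrite hornerZ hornerXn exprD; ring.
Qed.

Lemma coef_P (k : nat) : (k <= d.+1)%N ->
  P`_(d.+1 - k) = (-1) ^+ k * Sym k u.
Proof.
move=> kd; pose cs := [tuple u 0 i | i < d.+1].
have -> : Sym k u = (mesym d.+1 F k).@[tnth cs].
  by apply: meval_eq => i; rewrite tnth_mktuple.
have := mroots_coeff cs (inord k); rewrite inordK // big_tuple => <-.
by rewrite /P; under [in RHS]eq_bigr do rewrite tnth_mktuple.
Qed.

Lemma size_P : size P = d.+2.
Proof. by rewrite size_prod_XsubC /index_enum -enumT size_enum_ord. Qed.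

Lemma deriv_E : E^`() = (-1) ^+ d *: ('X^2 * P^`()).
Proof.
have -> : P^`() = \sum_(k < d.+1) P^`()`_k *: 'X^k.
  rewrite -poly_def; apply/polyP => i; rewrite coef_poly.
  case: ltnP => // di; rewrite nth_default // (leq_trans _ di) // -ltnS.
  by rewrite -size_P lt_size_deriv // -size_poly_gt0 size_P.
rewrite /E raddf_sum mulr_sumr scaler_sumr; apply: eq_bigr => k _ /=.
have kd : (k <= d)%N by rewrite -ltnS.
have -> : P^`()`_k = (-1) ^+ (d - k) * Sym (d - k) u * k.+1%:R.
  rewrite coef_deriv -coef_P; last by rewrite leqW ?leq_subr.
  by rewrite subSn ?leq_subr // subKn // mulr_natr.
rewrite derivZ derivXn addn3 /= -scaler_nat -scalerAr -exprD !scalerA add2n.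
apply: (congr1 (fun c => c *: _)); rewrite -[in (-1) ^+ d](subnK kd) exprD.
set e := (-1) ^+ (d - k); have ee : e * e = 1 by rewrite -expr2 sqrr_sign.
transitivity (e * e * ((-1) ^+ k * k.+1%:R * Sym (d - k) u)); last by ring.
rewrite ee mul1r mulrAC; congr (_ * _).
by rewrite -mulrA divfK // pnatr_eq0.
Qed.

Lemma deriv_W : W^`() = (2 * (-1) ^+ d) *: ('X * P).
Proof.
rewrite /W derivB deriv_E derivZ derivM derivXn /= -scalerBr addrK.
by rewrite mulrnAl -scaler_nat scalerA [_ * 2]mulrC.
Qed.

Lemma size_W : (size W <= d + 4)%N.
Proof.
rewrite (leq_trans (size_polyD _ _)) // geq_max size_polyN; apply/andP; split.
  rewrite (leq_trans (size_scale_leq _ _)) // (leq_trans (size_polyMleq _ _)) //.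
  by rewrite size_polyXn size_P !addSn add0n addn4.
apply: (leq_trans (size_sum _ _ _)); apply/bigmax_leqP => k _.
rewrite (leq_trans (size_scale_leq _ _)) // size_polyXn.
by rewrite -addnS leq_add2r -ltnS.
Qed.

Lemma gfun_eq0 : gfun u = 0 -> u = 0.
Proof.
move=> g0; pose s := 0 :: [seq u 0 j | j <- enum 'I_d.+1].
have sE : \prod_(b <- s) ('X - b%:P) = 'X * P.
  by rewrite big_cons subr0 big_map big_enum.
have Es b : b \in s -> root E b.
  rewrite inE => /orP[/eqP->|/mapP[l _ ->]].
    rewrite /root horner_sum big1 // => k _.
    by rewrite hornerZ hornerXn expr0n addn3 mulr0.
  by rewrite /root horner_E g0 mxE.
have Ws b : b \in s -> root W b.
  move=> bs; have : root ('X * P) b by rewrite -sE root_prod_XsubC.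
  rewrite /root /W hornerD hornerN hornerZ (eqP (Es b bs)) subr0.
  by move=> /rootP XP0; rewrite expr2 -mulrA [in X in _ * X]hornerM XP0 !mulr0.
have P0 : P != 0 by rewrite -size_poly_gt0 size_P.
have c0 : 2 * (-1) ^+ d != 0 :> F by rewrite mulf_eq0 signr_eq0 pnatr_eq0.
have W'0 : W^`() != 0.
  by rewrite deriv_W scaler_eq0 negb_or c0 mulf_neq0 ?polyX_eq0.
have W0 : W != 0 by apply: contraNneq W'0 => ->; rewrite deriv0.
have mupW b : b \in s -> (count_mem b s < mup b W)%N.
  move=> bs; apply: mup_primitive; rewrite ?Ws //.
  rewrite deriv_W -sE -mul_polyC mupMr ?mu_prod_XsubC //.
  by rewrite rootC.
apply/rowP => l; rewrite mxE; apply/eqP/negPn/negP => ul0.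
have ls : u 0 l \in s by rewrite inE map_f ?orbT ?mem_enum.
have : \prod_(b <- 0 :: u 0 l :: s) ('X - b%:P) %| W.
  apply: dvdp_prod_mup => // b bs; have bs' : b \in s.
    move: bs; rewrite inE => /orP[/eqP->|]; rewrite ?mem_head // inE.
    by move=> /orP[/eqP->|].
  apply: leq_trans (mupW b bs').
  change ((0 == b)%R + ((u 0 l == b)%R + count_mem b s) <= (count_mem b s).+1)%N.
  rewrite addnA -[leqRHS]add1n leq_add2r.
  by case: (eqVneq 0%R b) => [<-|_]; rewrite ?(negPf ul0) //; case: eqP.
move=> /(dvdp_leq W0); rewrite size_prod_XsubC /= size_map size_enum_ord.
by move=> /leq_trans /(_ size_W); rewrite addn4 ltnn.
Qed.

End Nondegeneracy.

Lemma gfun_neq0 (F : numFieldType) (d : nat) (u : 'rV[F]_d.+1) :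
  u != 0 -> gfun u != 0.
Proof. by apply: contra_neq; apply: gfun_eq0. Qed.

Definition gmap (F : numFieldType) (d : nat) : homog_map F d :=
  HomogMap (@gfun_homog F d) (@gfun_neq0 F d).

(* Main.v *)
Require Import Defs.
From mathcomp Require Import all_boot all_order all_algebra.
From mathcomp Require Import complex reals.
From mathcomp Require Import perm ring.

(** Let [Q = x (x - u_1) ... (x - u_(n-1))].  Up to a constant depending only
    on [n], the coordinate [g_l] is the integral of [Q] from [0] to [u_l].
    The involution [T] translates the set [{0, u_1, ..., u_(n-1)}] of roots of
    [Q] by [- u_1], exchanging [0] and [u_1]; hence the l-th coordinate of
    [g (T u)] is the integral of [Q] from [u_1] to [u_l] (to [0] when [l = 1]),
    that is, [g_l - g_1] (resp. [- g_1]).  The integral only depends on the set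
    of roots of [Q] and on the endpoint, so [g] commutes with permutations. *)

Set Implicit Arguments.
Unset Strict Implicit.
Unset Printing Implicit Defensive.

Import GRing.Theory Num.Theory.

Local Open Scope quotient_scope.
Local Open Scope ring_scope.

(** In characteristic 0 a vanishing derivative kills every coefficient of positive degree. *)
Lemma deriv_eq0_horner (F : numFieldType) (p : {poly F}) (x y : F) :
  p^`() = 0 -> p.[x] = p.[y].
Proof.
move=> p'0; suff /size1_polyC-> : (size p <= 1)%N by rewrite !hornerC.
apply/leq_sizeP => -[//|i] _; apply/eqP.
by have /polyP/(_ i)/eqP := p'0; rewrite coef_deriv coef0 mulrn_eq0.
Qed.

Section Equivariance.

Variables (F : numFieldType) (d : nat).
Implicit Types (u : 'rV[F]_d.+1) (p : {poly F}).

Definition root_poly u : {poly F} :=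
  'X * \prod_(j < d.+1) ('X - (u 0 j)%:P).

(** A relation, since [p] is fixed only up to a constant; the scalar is the one produced by
    [deriv_W]. *)
Definition g_primitive u p := p^`() = (2 * (-1) ^+ d) *: root_poly u.

Lemma g_primitive_ex u :
  exists2 p, g_primitive u p & forall l, gfun u 0 l = p.[0] - p.[u 0 l].
Proof.
have := deriv_W u; have := horner_E u; cbv zeta.
set E := (X in _ - X); set P := \prod_(j < _) _ => gE W'.
(* At a root [u_l] of [P] this witness reduces to [- E.[u_l]], and it vanishes at 0. *)
exists ((-1) ^+ d *: ('X^2 * P) - E) => // l.
have E0 : E.[0] = 0.
  by rewrite horner_sum big1 // => k _; rewrite hornerZ hornerXn addn3 expr0n mulr0.
have Pl : P.[u 0 l] = 0.
  by rewrite horner_prod (bigD1 l) //= hornerXsubC subrr mul0r.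
rewrite !hornerD !hornerN !hornerZ !hornerM !hornerX Pl E0 gE.
by rewrite !mul0r !mulr0 subr0 !sub0r opprK.
Qed.

(** Two primitives differ by a constant, which cancels in the difference of values. *)
Lemma gfun_primitive u p l : g_primitive u p -> gfun u 0 l = p.[0] - p.[u 0 l].
Proof.
move=> p'; have [q q' ->] := g_primitive_ex u.
have /(deriv_eq0_horner 0 (u 0 l)) : (q - p)^`() = 0.
  by rewrite derivB p' q' subrr.
by rewrite !hornerD !hornerN => /eqP; rewrite subr_eq => /eqP->; ring.
Qed.

Lemma root_poly_Tfun u :
  root_poly (Tfun u) = root_poly u \Po ('X + (u 0 ord0)%:P).
Proof.
rewrite /root_poly comp_polyM comp_polyX rmorph_prod /=.
rewrite !big_ord_recl /= !mxE eqxx comp_polyB comp_polyX comp_polyC addrK.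
(* [mulrCA] swaps the factors coming from the roots 0 and [u_1]. *)
rewrite polyCN opprK mulrCA; congr (_ * (_ * _)); apply: eq_bigr => j _.
by rewrite mxE /= comp_polyB comp_polyX comp_polyC polyCB opprB addrA addrAC.
Qed.

Lemma g_primitive_Tfun u p :
  g_primitive u p -> g_primitive (Tfun u) (p \Po ('X + (u 0 ord0)%:P)).
Proof.
move=> p'; rewrite /g_primitive deriv_comp p' root_poly_Tfun comp_polyZ.
by rewrite derivD derivX derivC addr0 mulr1.
Qed.

Lemma gfun_Tfun u : gfun (Tfun u) = Tfun (gfun u).
Proof.
have [p p' gE] := g_primitive_ex u; apply/rowP => l.
rewrite (gfun_primitive l (g_primitive_Tfun p')) [RHS]mxE !gE.
rewrite !horner_comp !hornerD !hornerX !hornerC add0r mxE.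
by case: eqP => _; rewrite ?addNr ?subrK; ring.
Qed.

Lemma root_poly_col_perm (s : 'S_d.+1) u :
  root_poly (col_perm s u) = root_poly u.
Proof.
rewrite /root_poly [in RHS](reindex_inj (@perm_inj _ s)) /=.
by congr (_ * _); apply: eq_bigr => j _; rewrite mxE.
Qed.

Lemma gfun_col_perm (s : 'S_d.+1) u : gfun (col_perm s u) = col_perm s (gfun u).
Proof.
have [p p' gE] := g_primitive_ex u; apply/rowP => l.
have sp' : g_primitive (col_perm s u) p by rewrite /g_primitive root_poly_col_perm.
by rewrite (gfun_primitive l sp') [RHS]mxE gE mxE.
Qed.

End Equivariance.

Lemma proj_map_comm (F : fieldType) (d : nat) (f h : homog_map F d) :
  (forall u, f (h u) = h (f u)) ->
  proj_map f \o proj_map h =1 proj_map h \o proj_map f.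
Proof.
move=> fh x; rewrite -[x]reprK /= !proj_map_pi; congr (\pi _).
exact/val_inj/fh.
Qed.

Lemma generated_group_comm (X : Type) (S : (X -> X) -> Prop) (g : X -> X) :
  (forall M, S M -> g \o M =1 M \o g) ->
  forall M, generated_group S M -> g \o M =1 M \o g.
Proof.
move=> Sg M; elim=> {M} [M /Sg //|//|f h _ gf _ gh x|f h _ gf fK hK x] /=.
  by rewrite [LHS]gf /= [g (h x)]gh.
(* For [h] inverse to [f]: [h g = h g f h = h f g h = g h]. *)
by rewrite -[in RHS](hK x) [g (f _)]gf /= fK.
Qed.

Theorem theorem4p1 (R : realType) (n : nat) (hn : (3 <= n)%N) :
  let g := proj_map (gmap R[i] n.-2) in
  let T := proj_map (Tmap R[i] n.-2) in
  g \o T =1 T \o g /\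
  (forall M : proj_space R[i] n.-2 -> proj_space R[i] n.-2,
     Ggroup M -> g \o M =1 M \o g).
Proof.
move=> g T; have gT : g \o T =1 T \o g by apply: proj_map_comm; apply: gfun_Tfun.
split=> //; apply: generated_group_comm => M [[s ->]|->] //.
by apply: proj_map_comm => u; apply: gfun_col_perm.
Qed.
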